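(* Let $X$ be a complete CAT$(0)$ space with metric $d$, let $r\ge1$ be an integer and let $C_1,\ldots,C_r\subseteq X$ be nonempty closed and convex sets such that $\bigcap_{i=1}^rC_i\neq\emptyset$. Let $(\varepsilon_n)_{n\in\mathbb{N}}$ be nonnegative reals with $\sum_{n=0}^\infty\varepsilon_n<\infty$, let $x_0\in X$ be any starting point, and let $(x_n)$ be any sequence in $X$ starting at $x_0$ with $$d(x_{n+1},P_{C_{\overline{n}}}x_n)\le\varepsilon_n\quad\text{for each } n\in\mathbb{N},$$ where $\overline{n}=(n\bmod r)+1$. Then $(x_n)$ $\Delta$-converges to some point $u\in\bigcap_{i=1}^rC_i$. Moreover, if there exists $i\in\{1,\ldots,r\}$ such that $C_i$ is locally compact, then $(x_n)$ converges to $u$ (in the metric $d$).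
   Context: $\mathbb{N}=\{0,1,2,\ldots\}$. A CAT$(0)$ space is a geodesic space of nonpositive curvature in the sense of Alexandrov. A subset is convex iff it contains all geodesic segments joining any two of its points. For $C$ nonempty closed convex in a complete CAT$(0)$ space, the metric projection $P_C(x)$ is the unique point $c\in C$ with $d(x,c)=\inf_{c'\in C}d(x,c')$. For a bounded sequence $(x_n)$ in $X$, an asymptotic center is a point $x\in X$ with $\limsup_n d(x,x_n)=\inf_{y\in X}\limsup_n d(y,x_n)$. A bounded sequence $(x_n)$ $\Delta$-converges to $x\in X$ iff $x$ is the unique asymptotic center of every subsequence of $(x_n)$. *)

(* Defs.v *)
From HB Require Import structures.
From mathcomp Require Import all_boot all_order all_algebra.
From mathcomp Require Import all_classical all_reals all_analysis.

Set Implicit Arguments.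
Unset Strict Implicit.
Unset Printing Implicit Defensive.

Import Order.TTheory GRing.Theory Num.Theory.
Import numFieldNormedType.Exports.

Local Open Scope classical_set_scope.
Local Open Scope ring_scope.

Section EuclideanPlane.
Variable R : realType.

(* The norm that the library puts on R * R is the sup norm. *)
Definition edist (p q : R * R) : R :=
  Num.sqrt ((p.1 - q.1) ^+ 2 + (p.2 - q.2) ^+ 2).

Definition esegment (p q : R * R) : set (R * R) :=
  [set m | exists2 l : R, 0 <= l <= 1 &
    m = ((1 - l) * p.1 + l * q.1, (1 - l) * p.2 + l * q.2)].

End EuclideanPlane.

Section CAT0.
Variables (R : realType) (X : metricType R).

Definition complete_space : Prop :=
  forall x : nat -> X, cauchy (x @ \oo) -> exists l : X, x @ \oo --> l.

(* Only the values of c on [0, d(x, y)] matter. *)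
Definition geodesic_path (x y : X) (c : R -> X) : Prop :=
  [/\ c 0 = x, c (mdist x y) = y &
      forall s t : R, 0 <= s <= mdist x y -> 0 <= t <= mdist x y ->
        mdist (c s) (c t) = `|s - t|].

Definition geodesic_segment (x y : X) (S : set X) : Prop :=
  exists2 c : R -> X, geodesic_path x y c &
    S = c @` [set t | 0 <= t <= mdist x y].

Definition geodesic_space : Prop :=
  forall x y : X, exists S : set X, geodesic_segment x y S.

Definition comparison_triangle (x y z : X) (x' y' z' : R * R) : Prop :=
  [/\ edist x' y' = mdist x y, edist y' z' = mdist y z &
      edist x' z' = mdist x z].

(* p' is the comparison point, on the segment [x', y'], of a point p of a
   geodesic segment joining x to y. *)
Definition comparison_point (x p : X) (x' y' p' : R * R) : Prop :=
  esegment x' y' p' /\ edist x' p' = mdist x p.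

(* Nonpositive curvature in the sense of Alexandrov: geodesic triangles are at
   least as thin as their Euclidean comparison triangles. Any two distinct
   sides share a vertex, which is called x here; for two points of the same
   side the inequality is an equality. *)
Definition cat0_space : Prop :=
  geodesic_space /\
  forall (x y z : X) (Sxy Syz Sxz : set X) (x' y' z' : R * R),
    geodesic_segment x y Sxy -> geodesic_segment y z Syz ->
    geodesic_segment x z Sxz -> comparison_triangle x y z x' y' z' ->
    forall (p q : X) (p' q' : R * R), Sxy p -> Sxz q ->
      comparison_point x p x' y' p' -> comparison_point x q x' z' q' ->
      mdist p q <= edist p' q'.

Definition geod_convex (C : set X) : Prop :=
  forall (x y : X) (S : set X), C x -> C y -> geodesic_segment x y S ->
    S `<=` C.

Definition nearest_point (C : set X) (x c : X) : Prop :=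
  C c /\ mdist x c = inf [set mdist x c' | c' in C].

(* When C is nonempty closed convex in a complete CAT(0) space there is exactly
   one nearest point; the default value x of xget is then not used. *)
Definition metric_proj (C : set X) (x : X) : X :=
  xget x [set c | nearest_point C x c].

Definition bounded_seq (x : nat -> X) : Prop :=
  exists (y : X) (M : R), forall n, mdist y (x n) <= M.

(* Meaningful for bounded x, for which limn_sup is the limit superior. *)
Definition asymptotic_center (x : nat -> X) (c : X) : Prop :=
  limn_sup (fun n => mdist c (x n)) =
  inf [set limn_sup (fun n => mdist y (x n)) | y in [set: X]].

Definition Delta_cvg (x : nat -> X) (u : X) : Prop :=
  bounded_seq x /\
  forall phi : nat -> nat, increasing_seq phi ->
    [set c | asymptotic_center (x \o phi) c] = [set u].

End CAT0.

Arguments complete_space {R} X.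
Arguments geodesic_space {R} X.
Arguments cat0_space {R} X.

(* Main.v *)
Require Import Defs.
From mathcomp Require Import all_boot all_order all_algebra.
From mathcomp Require Import all_classical all_reals all_analysis.
From mathcomp Require Import ring lra zify.

(** Comparison with Euclidean triangles makes the squared distance to a point
    uniformly convex along geodesics. This yields unique minimizers on closed
    convex sets, hence metric projections and asymptotic centers, and the
    inequality d(x, Px)^2 + d(Px, p)^2 <= d(x, p)^2 for p in C. By the latter,
    the distances from x_n to a common point p decrease up to summable errors,
    so they converge and d(x_n, P x_n) tends to 0; since consecutive terms get
    close, x_n approaches every C_i. An asymptotic center of a subsequence is
    then fixed by every projection, so it lies in the intersection, where the
    asymptotic radius of a subsequence is that of the whole sequence: all these
    centers agree. *)

Set Implicit Arguments.
Unset Strict Implicit.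
Unset Printing Implicit Defensive.

Import Order.TTheory GRing.Theory Num.Theory.
Import numFieldNormedType.Exports metricType_numDomainType.

Local Open Scope classical_set_scope.
Local Open Scope ring_scope.

(** * Real sequences: limits superior and almost monotone sequences *)

Section Sequences.
Variable R : realType.
Implicit Types a eps : nat -> R.

Lemma near_lt_of_limn_sup_lt a (M : R) :
  bounded_fun a -> limn_sup a < M -> \forall n \near \oo, a n < M.
Proof.
move=> ba; rewrite limn_supE// => /inf_lt[|_ [N _ <-] supM].
  by exists (sups a 0%N), 0%N.
exists N => // n /= Nn; apply: le_lt_trans supM; apply: ub_le_sup; last by exists n.
have [B aB] := bounded_fun_has_ubound ba.
by exists B => _ [k _ <-]; apply: aB; exists k.
Qed.

Lemma limn_sup_le_of_near a (M : R) :
  bounded_fun a -> (\forall n \near \oo, a n <= M) -> limn_sup a <= M.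
Proof.
move=> ba [N _ aM]; rewrite limn_supE//.
have := bounded_fun_has_lbound_sups ba => lb.
apply: (@le_trans _ _ (sups a N)).
  by apply: ge_inf => //; exists N.
apply: ge_sup; first by exists (a N), N => /=.
by move=> _ [k /= Nk <-]; exact: aM.
Qed.

Lemma is_cvg_series_of_nneseries eps :
  (forall n, 0 <= eps n) -> (\sum_(0 <= n <oo) (eps n)%:E < +oo)%E ->
  cvgn (series eps).
Proof.
move=> eps0 sum_fin; apply: nondecreasing_is_cvgn.
  by apply: nondecreasing_series => n _ _; exact: eps0.
have S0 : (0 <= \sum_(0 <= n <oo) (eps n)%:E)%E.
  by apply: nneseries_ge0 => n _ _; rewrite lee_fin.
exists (fine (\sum_(0 <= n <oo) (eps n)%:E)%E) => _ [n _ <-].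
rewrite -lee_fin fineK ?ge0_fin_numE// /series/= -sumEFin.
by apply: nneseries_lim_ge => k _ _; rewrite lee_fin.
Qed.

(* Subtracting the partial sums of the errors makes the sequence nonincreasing. *)
Lemma is_cvg_quasi_nonincreasing a eps :
  (forall n, 0 <= a n) -> cvgn (series eps) ->
  (forall n, a n.+1 <= a n + eps n) -> cvgn a.
Proof.
move=> a0 cvg_eps a_le.
have -> : a = (a \- series eps) \+ series eps.
  by apply/funext => n /=; rewrite subrK.
apply: is_cvgD => //; apply: nonincreasing_is_cvgn.
  apply/nonincreasing_seqP => n /=.
  by rewrite /series/= big_nat_recr//=; have := a_le n; lra.
have [B epsB] := bounded_fun_has_ubound (cvg_seq_bounded cvg_eps).
exists (- B) => _ [n _ <-] /=; rewrite lerBrDr.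
have := a0 n; have : series eps n <= B by apply: epsB; exists n.
by lra.
Qed.

Lemma bounded_fun_itv a (l M : R) : (forall n, l <= a n <= M) -> bounded_fun a.
Proof.
move=> aM; exists (Num.max `|l| `|M|); split; first exact: num_real.
move=> B /ltW lB n _ /=; apply: le_trans lB; rewrite le_max.
have /andP[la aMn] := aM n.
have [a0|/ltW a0] := leP 0 (a n).
  by rewrite (ger0_norm a0) (le_trans aMn (ler_norm _)) orbT.
by rewrite (ler0_norm a0) -normrN (le_trans _ (ler_norm _)) ?lerN2.
Qed.

End Sequences.

(** * Comparison triangles and uniform convexity of squared distances *)

Section Distance.
Variables (R : realType) (X : metricType R).
Implicit Types (x y z p : X) (C : set X).

(** By the law of cosines, this puts the cosine of the comparison angle at [x] in [-1, 1], which is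
    what makes comparison triangles exist. *)
Lemma mdist_triangle_sq x y z : `|mdist x y ^+ 2 + mdist x z ^+ 2 - mdist y z ^+ 2|
  <= 2 * mdist x y * mdist x z.
Proof.
have := metric_triangle y x z; have := metric_triangle x y z.
have := metric_triangle x z y.
rewrite (metric_sym z y) (metric_sym y x) => h1 h2 h3.
have := mdist_ge0 x y; have := mdist_ge0 x z; have := mdist_ge0 y z => ? ? ?.
rewrite ler_norml; apply/andP; split; nra.
Qed.

(** The law of cosines dictates the first coordinate of [v]. The two squared identities are recorded
    so that later estimates reduce to algebra. *)
Lemma comparison_triangle_exists x y z :
  exists (v : R * R), [/\ comparison_triangle x y z (0, 0) (mdist x y, 0) v,
    v.1 ^+ 2 + v.2 ^+ 2 = mdist x z ^+ 2 &
    2 * mdist x y * v.1 = mdist x y ^+ 2 + mdist x z ^+ 2 - mdist y z ^+ 2].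
Proof.
set D := mdist x y; set b := mdist x z; set c := mdist y z.
have D0 : 0 <= D := mdist_ge0 _ _.
have b0 : 0 <= b := mdist_ge0 _ _.
have c0 : 0 <= c := mdist_ge0 _ _.
suff [v [v1 v2]] : exists v : R * R, v.1 ^+ 2 + v.2 ^+ 2 = b ^+ 2 /\
    2 * D * v.1 = D ^+ 2 + b ^+ 2 - c ^+ 2.
  exists v; split => //; split; rewrite /Defs.edist/=.
  - by rewrite !sub0r oppr0 expr0n addr0 sqrrN sqrtr_sqr ger0_norm.
  - have -> : (D - v.1) ^+ 2 + (0 - v.2) ^+ 2 = c ^+ 2 by nra.
    by rewrite sqrtr_sqr ger0_norm.
  - by rewrite !sub0r !sqrrN v1 sqrtr_sqr ger0_norm.
(* If [x = y], the law of cosines leaves the first coordinate free, and any point at distance [b]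
   from the origin serves. *)
have [D_eq0|D_neq0] := eqVneq D 0.
  have xy : x = y by apply: mdist_positivity.
  have -> : c = b by rewrite /c /b xy.
  by exists (b, 0) => /=; rewrite D_eq0; split; ring.
have D_gt0 : 0 < D by rewrite lt_neqAle eq_sym D_neq0.
pose u := (D ^+ 2 + b ^+ 2 - c ^+ 2) / (2 * D).
have Du : 2 * D * u = D ^+ 2 + b ^+ 2 - c ^+ 2 by rewrite /u; field.
have ub : u ^+ 2 <= b ^+ 2.
  have := mdist_triangle_sq x y z; rewrite -/D -/b -/c -Du.
  rewrite normrM (ger0_norm (_ : 0 <= 2 * D)) ?mulr_ge0// ler_pM2l ?mulr_gt0//.
  by move=> ub; rewrite -real_normK ?num_real// ler_sqr ?nnegrE.
exists (u, Num.sqrt (b ^+ 2 - u ^+ 2)) => /=; split => //.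
by rewrite sqr_sqrtr ?subr_ge0//; ring.
Qed.

(** In the comparison triangle the last bound is an equality, Stewart's theorem; thinness carries it
    over to [X]. The same [m] serves every [x], which later allows passing to limits superior. *)
Lemma cat0_geodesic_point y z (t : R) : cat0_space X -> 0 <= t <= 1 ->
  exists m, [/\ mdist y m = t * mdist y z, mdist m z = (1 - t) * mdist y z,
    (forall C, geod_convex C -> C y -> C z -> C m) &
    forall x, mdist x m ^+ 2 <= (1 - t) * mdist x y ^+ 2 +
      t * mdist x z ^+ 2 - t * (1 - t) * mdist y z ^+ 2].
Proof.
move=> [geo thin] /andP[t0 t1].
have [Syz hS] := geo y z; have [c [c0 c1 ci] SE] := hS.
set D := mdist y z.
have D0 : 0 <= D := mdist_ge0 _ _.
have tD : 0 <= t * D <= mdist y z by rewrite -/D; apply/andP; split; nra.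
have ym : mdist y (c (t * D)) = t * D.
  rewrite -{1}c0 ci// ?lexx//= sub0r normrN ger0_norm//; nra.
exists (c (t * D)); split => //.
- rewrite -{1}c1 ci// ?lexx ?D0 ?andbT// -/D ler0_norm; nra.
- move=> C cvC Cy Cz; apply: (cvC y z Syz) => //.
  by rewrite SE; exists (t * D).
move=> x.
have [Szx hSzx] := geo z x; have [Syx hSyx] := geo y x.
have [v [tri v1 v2]] := comparison_triangle_exists y z x.
have [e [e0 e1 _] SyxE] := hSyx.
(* Thinness is applied at the shared vertex [y]; the second point is the vertex [x] itself, as the
   endpoint of [Syx]. *)
have le_e : mdist x (c (t * D)) <= Defs.edist (t * D, 0) v.
  rewrite metric_sym; apply: (thin _ _ _ _ _ _ _ _ _ hS hSzx hSyx tri).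
  - by rewrite SE; exists (t * D).
  - by rewrite SyxE; exists (mdist y x) => //=; rewrite mdist_ge0 lexx.
  - split; first by exists t; [rewrite t0|rewrite /= -/D; congr pair; ring].
    rewrite ym /Defs.edist/= !sub0r oppr0 sqrrN expr0n addr0 sqrtr_sqr ger0_norm//.
    nra.
  - split; last by case: tri.
    by exists 1; [rewrite ler01 lexx|case: (v) => /= ? ?; congr pair; ring].
have e_ge0 : 0 <= Defs.edist (t * D, 0) v by apply: sqrtr_ge0.
apply: (@le_trans _ _ (Defs.edist (t * D, 0) v ^+ 2)).
  by rewrite ler_sqr ?nnegrE ?mdist_ge0.
rewrite /Defs.edist sqr_sqrtr/=; last by rewrite addr_ge0// sqr_ge0.
rewrite -/D (metric_sym y x) (metric_sym z x) in v1 v2 *.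
nra.
Qed.

End Distance.

(** * Minimization of uniformly convex functions *)

Section Minimization.
Variables (R : realType) (X : metricType R).
Implicit Types (x y z p : X) (C : set X) (g : X -> R).

(** Midpoint form for the square of [g], with any [m] in [C] allowed as midpoint. It covers both the
    distance to a point and the asymptotic radius. *)
Definition unif_convex_on C g := forall y z, C y -> C z ->
  exists2 m, C m & g m ^+ 2 <= (g y ^+ 2 + g z ^+ 2) / 2 - mdist y z ^+ 2 / 4.

(** Two distinct minimizers would yield a point [m] with a strictly smaller value. *)
Lemma unif_convex_argmin_unique C g c c' : (forall y, 0 <= g y) ->
  unif_convex_on C g -> C c -> C c' -> (forall y, C y -> g c <= g y) ->
  g c' <= g c -> c = c'.
Proof.
move=> g0 cvx Cc Cc' cmin le_c'c; have [m Cm gm] := cvx _ _ Cc Cc'.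
have := cmin m Cm; have := g0 m; have := g0 c; have := g0 c' => h1 h2 h3 h4.
have d0 := mdist_ge0 c c'.
by apply: mdist_positivity; nra.
Qed.

(** Uniform convexity bounds the distance between near-minimizers, so a minimizing sequence is
    Cauchy; the Lipschitz bound makes its limit a minimizer. *)
Lemma unif_convex_argmin C g : complete_space X -> closed C -> C !=set0 ->
  (forall y, 0 <= g y) -> (forall y z, g y <= g z + mdist y z) ->
  unif_convex_on C g -> exists2 c, C c & forall y, C y -> g c <= g y.
Proof.
move=> complX clC [c0 Cc0] g0 glip cvx.
pose D := inf (g @` C).
have hinf : has_inf (g @` C).
  by split; [exists (g c0), c0|exists 0 => _ [y _ <-]].
have D0 : 0 <= D by apply: lb_le_inf => [|_ [y _ <-]//]; exists (g c0), c0.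
have Dle y : C y -> D <= g y by move=> Cy; apply: ge_inf; [case: hinf|exists y].
have appr n : exists y, C y /\ g y < D + n.+1%:R^-1.
  have [|_ [y Cy <-] gy] := @inf_adherent _ (g @` C) n.+1%:R^-1 _ hinf.
    by rewrite invr_gt0.
  by exists y.
pose y_ n := sval (cid (appr n)).
have Cy n : C (y_ n) by rewrite /y_; case: cid => ? [].
have gy n : g (y_ n) < D + n.+1%:R^-1 by rewrite /y_; case: cid => ? [].
have near_g e : 0 < e -> \forall n \near \oo, g (y_ n) < D + e.
  move=> e0; near=> n; apply: lt_trans (gy n) _; rewrite ltrD2l.
  by near: n; exact: near_infty_natSinv_lt (PosNum e0).
have [|l yl] := complX y_.
  apply/cauchy_ballP => e e0.
  (* Two values below [D + d] and a value at least [D] at [m] force the squared distance below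
     [4 * ((D + d) ^+ 2 - D ^+ 2)], which is at most [d * (8 * D + 8)] since [d <= 1]. *)
  pose d := Num.min 1 (e ^+ 2 / (8 * D + 8)).
  have den : 0 < 8 * D + 8 by lra.
  have d0 : 0 < d by rewrite lt_min ltr01/= divr_gt0// exprn_gt0.
  have d1 : d <= 1 by rewrite ge_min lexx.
  have de : d * (8 * D + 8) <= e ^+ 2 by rewrite -ler_pdivlMr// ge_min lexx orbT.
  have near_d := near_g _ d0.
  have close y z : C y -> C z -> g y < D + d -> g z < D + d -> ball y e z.
    move=> Cy' Cz gyd gzd; rewrite ballEmdist/=.
    have [m Cm gm] := cvx _ _ Cy' Cz; have Dm := Dle m Cm.
    have := g0 y; have := g0 z => gz0 gy0.
    rewrite -(@ltr_pXn2r _ 2) ?nnegrE ?mdist_ge0 ?(ltW e0)//.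
    have : g y ^+ 2 < (D + d) ^+ 2 by rewrite ltr_pXn2r ?nnegrE//; lra.
    have : g z ^+ 2 < (D + d) ^+ 2 by rewrite ltr_pXn2r ?nnegrE//; lra.
    have : D ^+ 2 <= g m ^+ 2 by rewrite ler_sqr ?nnegrE.
    nra.
  near=> y z.
  have [Cy' gy'] : C y /\ g y < D + d.
    by near: y; apply: filterS near_d => n gn; split.
  have [Cz gz] : C z /\ g z < D + d.
    by near: z; apply: filterS near_d => n gn; split.
  exact: close.
have Cl : C l by apply: (closed_cvg _ clC _ _ yl); exact: nearW.
exists l => // y Cy'; apply: le_trans (Dle y Cy').
apply/ler_addgt0Pr => e e0.
have e20 : 0 < e / 2 by rewrite divr_gt0.
have near1 := near_g _ e20.
have near2 : \forall n \near \oo, mdist l (y_ n) < e / 2 by exact: cvgr_dist_lt.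
have [n [h1 h2]] := filter_ex (filterI near1 near2).
have := glip l (y_ n); lra.
Unshelve. all: by end_near. Qed.
End Minimization.

(** * Metric projections onto closed convex sets *)

Section Projection.
Variables (R : realType) (X : metricType R).
Hypotheses (complX : complete_space X) (catX : cat0_space X).
Implicit Types (x y z p c : X) (C : set X).

Lemma half_itv : 0 <= (2^-1 : R) <= 1.
Proof. by apply/andP; split; lra. Qed.

Lemma nearest_pointP C x c :
  nearest_point C x c <-> C c /\ forall y, C y -> mdist x c <= mdist x y.
Proof.
have lb : has_lbound [set mdist x c' | c' in C].
  by exists 0 => _ [y _ <-]; exact: mdist_ge0.
split=> [[Cc eq_c]|[Cc cmin]]; split=> //.
  by move=> y Cy; rewrite eq_c; apply: ge_inf => //; exists y.
apply/eqP; rewrite eq_le; apply/andP; split.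
  by apply: lb_le_inf => [|_ [y Cy <-]]; [exists (mdist x c), c|exact: cmin].
by apply: ge_inf => //; exists c.
Qed.

Lemma metric_projP C x : closed C -> geod_convex C -> C !=set0 ->
  nearest_point C x (metric_proj C x).
Proof.
move=> clC cvC C0; apply: xgetPex => /=.
have [|||c Cc cmin] := @unif_convex_argmin _ _ C (mdist x) complX clC C0.
- by move=> y; exact: mdist_ge0.
- by move=> y z; rewrite (metric_sym y); exact: metric_triangle.
- move=> y z Cy Cz; have [m [_ _ mC mx]] := cat0_geodesic_point y z catX half_itv.
  by exists m; [exact: mC|have := mx x; lra].
by exists c; apply/nearest_pointP.
Qed.

(* The angle at the projection is at least a right angle: compare c with points
   of the geodesic [c, p] tending to c. *)
Lemma nearest_point_pythagoras C x c p : geod_convex C -> nearest_point C x c ->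
  C p -> mdist x c ^+ 2 + mdist c p ^+ 2 <= mdist x p ^+ 2.
Proof.
move=> cvC /nearest_pointP[Cc cmin] Cp.
apply/ler_addgt0Pr => e e0.
set q := mdist c p ^+ 2; have q0 : 0 <= q by exact: sqr_ge0.
(* With this [t], the term [t * q] left over after division by [t] is at most [e]. *)
pose t := Num.min 1 (e / (q + 1)).
have t0 : 0 < t by rewrite lt_min ltr01/= divr_gt0//; lra.
have t1 : t <= 1 by rewrite ge_min lexx.
have te : t * (q + 1) <= e by rewrite -ler_pdivlMr ?ge_min ?lexx ?orbT//; lra.
have [|m [_ _ mC mx]] := @cat0_geodesic_point _ _ c p t catX.
  by rewrite (ltW t0).
have := cmin m (mC C cvC Cc Cp).
rewrite -ler_sqr ?nnegrE ?mdist_ge0// => le_cm.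
have := le_trans le_cm (mx x); rewrite -/q => le_q.
have : t * (mdist x c ^+ 2 + (1 - t) * q) <= t * mdist x p ^+ 2 by lra.
rewrite ler_pM2l//; nra.
Qed.

Lemma metric_proj_quasi_nonexpansive C x p : closed C -> geod_convex C -> C p ->
  mdist (metric_proj C x) p <= mdist x p.
Proof.
move=> clC cvC Cp; have C0 : C !=set0 by exists p.
have := nearest_point_pythagoras cvC (metric_projP x clC cvC C0) Cp.
rewrite -[mdist _ p <= _]ler_sqr ?nnegrE ?mdist_ge0//.
by apply: le_trans; rewrite lerDr sqr_ge0.
Qed.
End Projection.

(** * Asymptotic radii and centers *)

Section AsymptoticCenter.
Variables (R : realType) (X : metricType R).
Implicit Types (x : nat -> X) (y z c : X).

Definition asymptotic_radius x y : R := limn_sup (fun n => mdist y (x n)).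

Variable x : nat -> X.
Hypothesis bx : bounded_seq x.

Lemma bounded_fun_mdist y : bounded_fun (fun n => mdist y (x n)).
Proof.
have [b [M bM]] := bx.
apply: (@bounded_fun_itv _ _ 0 (mdist y b + M)) => n; rewrite mdist_ge0/=.
by apply: le_trans (metric_triangle _ b _) _; rewrite lerD2l.
Qed.

Lemma asymptotic_radius_near y e : 0 < e ->
  \forall n \near \oo, mdist y (x n) < asymptotic_radius x y + e.
Proof.
move=> e0; apply: near_lt_of_limn_sup_lt; first exact: bounded_fun_mdist.
by rewrite ltrDl.
Qed.

Lemma asymptotic_radius_le y M : (\forall n \near \oo, mdist y (x n) <= M) ->
  asymptotic_radius x y <= M.
Proof. exact/limn_sup_le_of_near/bounded_fun_mdist. Qed.

Lemma asymptotic_radius_ge0 y : 0 <= asymptotic_radius x y.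
Proof.
apply/ler_addgt0Pr => e /(asymptotic_radius_near y)/filter_ex[n /ltW].
exact: le_trans (mdist_ge0 _ _).
Qed.

Lemma asymptotic_radius_lip y z :
  asymptotic_radius x y <= asymptotic_radius x z + mdist y z.
Proof.
apply/ler_addgt0Pr => e /(asymptotic_radius_near z) near_e.
apply: asymptotic_radius_le; apply: filterS near_e => n.
by have := metric_triangle y z (x n); lra.
Qed.

Lemma asymptotic_centerP c : asymptotic_center x c <->
  forall y, asymptotic_radius x c <= asymptotic_radius x y.
Proof.
rewrite /asymptotic_center -/(asymptotic_radius x c).
rewrite (_ : [set _ | y in _] = range (asymptotic_radius x)); last by [].
have lb : has_lbound (range (asymptotic_radius x)).
  by exists 0 => _ [y _ <-]; exact: asymptotic_radius_ge0.
split=> [-> y|cmin]; first by apply: ge_inf => //; exists y.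
apply/eqP; rewrite eq_le; apply/andP; split.
  by apply: lb_le_inf => [|_ [y _ <-]//]; exists (asymptotic_radius x c), c.
by apply: ge_inf => //; exists c.
Qed.

(** The midpoint of [y] and [z] obeys the convexity inequality against all [x n] at once, so the
    inequality survives the limit superior. *)
Lemma asymptotic_radius_unif_convex : cat0_space X ->
  unif_convex_on setT (asymptotic_radius x).
Proof.
move=> catX y z _ _.
have [m [_ _ _ mx]] := cat0_geodesic_point y z catX (half_itv R).
exists m => //; set f := asymptotic_radius x.
have fy0 : 0 <= f y := asymptotic_radius_ge0 y.
have fz0 : 0 <= f z := asymptotic_radius_ge0 z.
apply/ler_addgt0Pr => e e0.
(* Adding [d] to [f y] and [f z] raises the mean of their squares by [d * (f y + f z) + d ^+ 2], at
   most [e] since [d <= 1]. *)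
pose d := Num.min 1 (e / (f y + f z + 1)).
have den : 0 < f y + f z + 1 by lra.
have d0 : 0 < d by rewrite lt_min ltr01/= divr_gt0.
have d1 : d <= 1 by rewrite ge_min lexx.
have de : d * (f y + f z + 1) <= e by rewrite -ler_pdivlMr// ge_min lexx orbT.
pose Q := ((f y + d) ^+ 2 + (f z + d) ^+ 2) / 2 - mdist y z ^+ 2 / 4.
have near_Q : \forall n \near \oo, mdist m (x n) ^+ 2 <= Q.
  apply: filterS (filterI (asymptotic_radius_near y d0) (asymptotic_radius_near z d0)).
  move=> n [/ltW ny /ltW nz]; have := mx (x n).
  rewrite -ler_sqr ?nnegrE ?mdist_ge0 ?addr_ge0 ?(ltW d0)// in ny.
  rewrite -ler_sqr ?nnegrE ?mdist_ge0 ?addr_ge0 ?(ltW d0)// in nz.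
  rewrite !(metric_sym (x n)) -/f in ny nz * => h; rewrite /Q; lra.
have Q0 : 0 <= Q.
  by have [n] := filter_ex near_Q; apply: le_trans; exact: sqr_ge0.
have fmQ : f m <= Num.sqrt Q.
  apply: asymptotic_radius_le; apply: filterS near_Q => n nQ.
  by rewrite -(ger0_norm (mdist_ge0 m (x n))) -sqrtr_sqr ler_wsqrtr.
have fm2 : f m ^+ 2 <= Q.
  by rewrite -[leRHS](sqr_sqrtr Q0) ler_sqr ?nnegrE ?sqrtr_ge0// asymptotic_radius_ge0.
apply: le_trans fm2 _; rewrite /Q; nra.
Qed.

Lemma asymptotic_center_exists : complete_space X -> cat0_space X ->
  exists c, asymptotic_center x c.
Proof.
move=> complX catX.
have [|c _ cmin] := unif_convex_argmin complX closedT _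
  asymptotic_radius_ge0 asymptotic_radius_lip (asymptotic_radius_unif_convex catX).
  by exists (x 0%N).
by exists c; apply/asymptotic_centerP => y; exact: cmin.
Qed.

Lemma asymptotic_center_unique c c' : cat0_space X -> asymptotic_center x c ->
  asymptotic_radius x c' <= asymptotic_radius x c -> c = c'.
Proof.
move=> catX /asymptotic_centerP cmin le_c'c.
apply: (@unif_convex_argmin_unique _ _ setT (asymptotic_radius x)) => //.
- exact: asymptotic_radius_ge0.
- exact: asymptotic_radius_unif_convex.
Qed.
End AsymptoticCenter.

(** * Subsequences *)

Lemma increasing_seq_cvgnoo (phi : nat -> nat) :
  increasing_seq phi -> phi n @[n --> \oo] --> \oo.
Proof.
move=> /increasing_seqP phiS; have phi_ge n : (n <= phi n)%N.
  by elim: n => // n ih; apply: leq_ltn_trans ih _; have := phiS n; rewrite ltEnat.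
by move=> A [N _ NA]; exists N => // n /= Nn; apply: NA; exact: leq_trans (phi_ge n).
Qed.

Lemma frequently_subsequence (P : nat -> Prop) :
  (forall N, exists2 n, (N <= n)%N & P n) ->
  exists2 phi : nat -> nat, increasing_seq phi & forall n, P (phi n).
Proof.
move=> freq; pose f N := s2val (cid2 (freq N)).
have f_ge N : (N <= f N)%N by rewrite /f; case: cid2.
have Pf N : P (f N) by rewrite /f; case: cid2.
(* Searching from the successor of the last index makes the indices strictly increase. *)
exists (fun n => iter n (f \o succn) (f 0%N)); last by case=> [|n] /=; exact: Pf.
by apply/increasing_seqP => n; rewrite ltEnat/=; exact: f_ge.
Qed.

(** * Delta-convergence and metric convergence of Fejér-type sequences *)

Section FejerConvergence.
Variables (R : realType) (X : metricType R).
Hypotheses (complX : complete_space X) (catX : cat0_space X).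
Implicit Types (x : nat -> X) (C : set X) (phi : nat -> nat).

Definition asymptotically_in C x :=
  mdist (x n) (metric_proj C (x n)) @[n --> \oo] --> 0.

Lemma asymptotically_in_near C x e : asymptotically_in C x -> 0 < e ->
  \forall n \near \oo, mdist (x n) (metric_proj C (x n)) < e.
Proof. by move=> xC e0; exact: (cvgr_lt _ xC _ e0). Qed.

Lemma asymptotically_in_subseq C x phi : asymptotically_in C x ->
  increasing_seq phi -> asymptotically_in C (x \o phi).
Proof. by move=> xC /increasing_seq_cvgnoo phioo; exact: cvg_comp phioo xC. Qed.

Lemma bounded_subseq x phi : bounded_seq x -> bounded_seq (x \o phi).
Proof. by move=> [y [M yM]]; exists y, M => n; exact: yM. Qed.

Lemma asymptotic_radius_subseq x phi p : cvgn (fun n => mdist p (x n)) ->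
  increasing_seq phi ->
  asymptotic_radius (x \o phi) p = limn (fun n => mdist p (x n)).
Proof.
move=> cvgp /increasing_seq_cvgnoo phioo.
have cvg_phi := cvg_comp _ _ phioo cvgp.
rewrite /asymptotic_radius cvg_limn_supE; first exact: cvg_lim.
by apply/cvg_ex; exists (limn (fun n => mdist p (x n))).
Qed.

Lemma asymptotic_radius_cvg x p : cvgn (fun n => mdist p (x n)) ->
  asymptotic_radius x p = limn (fun n => mdist p (x n)).
Proof. by move=> cvgp; exact: (@asymptotic_radius_subseq x id). Qed.

(* The projection onto C does not increase the asymptotic radius. *)
Lemma asymptotic_center_in C x c : closed C -> geod_convex C -> C !=set0 ->
  bounded_seq x -> asymptotically_in C x -> asymptotic_center x c -> C c.
Proof.
move=> clC cvC C0 bx xC cx.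
have CP y : C (metric_proj C y) by case: (metric_projP complX catX y clC cvC C0).
rewrite (_ : c = metric_proj C c)//.
apply: (asymptotic_center_unique bx catX cx).
apply/ler_addgt0Pr => e e0; have e40 : 0 < e / 4 by rewrite divr_gt0.
apply: asymptotic_radius_le => //.
have near1 := asymptotic_radius_near bx c e40.
apply: filterS (filterI near1 (asymptotically_in_near xC e40)) => n [h1 h2].
(* The reference point in [C] moves with [n]: it is the projection of [x n], which gets close to
   [x n]. *)
have h3 := metric_proj_quasi_nonexpansive complX catX c clC cvC (CP (x n)).
have h4 := metric_triangle (metric_proj C c) (metric_proj C (x n)) (x n).
have h5 := metric_triangle c (x n) (metric_proj C (x n)).
rewrite (metric_sym (metric_proj C (x n)) (x n)) in h4; lra.
Qed.

(** Centers of subsequences lie in every [C i], where distances to [x n] converge and radii are the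
    same along all subsequences. So a center [c] of a subsequence has, for the whole sequence, a
    radius no larger than that of [u], and uniqueness gives [u = c]. *)
Lemma fejer_Delta_cvg (I : Type) (C : I -> set X) x :
  (forall i, closed (C i)) -> (forall i, geod_convex (C i)) ->
  (forall i, C i !=set0) -> bounded_seq x ->
  (forall i, asymptotically_in (C i) x) ->
  (forall p, (\bigcap_i C i) p -> cvgn (fun n => mdist p (x n))) ->
  exists2 u, (\bigcap_i C i) u & Delta_cvg x u.
Proof.
move=> clC cvC C0 bx xC cvgx.
have inF phi c : increasing_seq phi -> asymptotic_center (x \o phi) c ->
    (\bigcap_i C i) c.
  move=> incr cx i _; apply: (asymptotic_center_in (clC i) (cvC i) (C0 i) _ _ cx).
    exact: bounded_subseq.
  exact: asymptotically_in_subseq.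
have [u ux] := asymptotic_center_exists bx complX catX.
have Fu : (\bigcap_i C i) u by apply: (inF id).
exists u => //; split=> // phi incr.
have bxphi := bounded_subseq phi bx.
have center_u c : asymptotic_center (x \o phi) c -> u = c.
  move=> cx; have Fc := inF _ _ incr cx.
  apply: (asymptotic_center_unique bx catX ux).
  rewrite !asymptotic_radius_cvg; [|exact: cvgx..].
  rewrite -(asymptotic_radius_subseq (cvgx _ Fc) incr).
  rewrite -(asymptotic_radius_subseq (cvgx _ Fu) incr).
  by move/(asymptotic_centerP bxphi): cx; exact.
apply/seteqP; split=> [c /= /center_u->//|_ /= ->].
have [c cx] := asymptotic_center_exists bxphi complX catX.
by rewrite (center_u c cx).
Qed.

(* If the distances to u tended to rho > 0, points w_n at a fixed small fraction
   of the geodesics from u to the projections of x_n would cluster, in a compact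
   neighborhood of u, at a point w that is asymptotically closer than u to a
   subsequence. *)
Lemma Delta_cvg_locally_compact C x u : closed C -> geod_convex C ->
  locally_compact C -> C u -> Delta_cvg x u -> asymptotically_in C x ->
  cvgn (fun n => mdist u (x n)) -> x @ \oo --> u.
Proof.
move=> clC cvC lcC Cu [bx centers] xC cvgu.
have C0 : C !=set0 by exists u.
set rho := limn (fun n => mdist u (x n)) in cvgu.
have near_rho e : 0 < e -> \forall n \near \oo, mdist u (x n) < rho + e.
  by move=> e0; apply: (cvgr_lt _ cvgu); rewrite ltrDl.
have rho0 : 0 <= rho.
  by apply: limr_ge => //; apply: nearW => n; exact: mdist_ge0.
have [rho_eq0|rho_neq0] := eqVneq rho 0.
  by apply/cvgrPdist_lt => e e0; have := near_rho e e0; rewrite rho_eq0 add0r.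
have {rho_neq0}rho0 : 0 < rho by rewrite lt_neqAle eq_sym rho_neq0.
exfalso.
have [K nbhsK [cptK _]] := lcC u Cu.
have [d d0 ballK] : exists2 d, 0 < d & forall y, mdist u y < d -> C y -> K y.
  by move: nbhsK; rewrite /within/= => /nbhs_mdistP[d d0 dK]; exists d.
(* Eventually [mdist u (c n) < rho + 1], so this [t] keeps [w n] within [d] of [u], where [ballK]
   puts it into [K]. *)
pose t := Num.min 1 (d / (rho + 2)).
have den : 0 < rho + 2 by lra.
have t0 : 0 < t by rewrite lt_min ltr01/= divr_gt0.
have t1 : t <= 1 by rewrite ge_min lexx.
have td : t * (rho + 2) <= d by rewrite -ler_pdivlMr// ge_min lexx orbT.
pose c n := metric_proj C (x n).
have Cc n : C (c n) by case: (metric_projP complX catX (x n) clC cvC C0).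
have t01 : 0 <= t <= 1 by rewrite (ltW t0).
have /choice[w hw] n : exists m, [/\ mdist u m = t * mdist u (c n),
    mdist m (c n) = (1 - t) * mdist u (c n) & C m].
  have [m [h1 h2 h3 _]] := cat0_geodesic_point u (c n) catX t01.
  by exists m; split => //; exact: h3.
have near_c e : 0 < e -> \forall n \near \oo,
    mdist u (c n) < rho + e /\ mdist (x n) (c n) < e.
  move=> e0; have e20 : 0 < e / 2 by rewrite divr_gt0.
  apply: filterS (filterI (near_rho _ e20) (asymptotically_in_near xC e20)).
  move=> n [h1 h2]; rewrite -/(c n) in h2.
  by have := metric_triangle u (x n) (c n); split; lra.
have wK : (w @ \oo) K.
  apply: filterS (near_c 1 ltr01) => n [h1 _]; have [uw _ Cw] := hw n.
  by apply: ballK => //; rewrite uw; have := mdist_ge0 u (c n); nra.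
have [v [_ clv]] := cptK _ _ wK.
(* Going from [v] to [x n] through [w n] and [c n] costs at most [e + (1 - t) * (rho + e) + e],
   hence at most [rho - t * rho + 3 * e], which is [rho - e]. *)
pose e := t * rho / 4.
have e0 : 0 < e by rewrite divr_gt0// mulr_gt0.
have [phi incr phi_le] : exists2 phi, increasing_seq phi &
    forall n, mdist v (x (phi n)) <= rho - e.
  apply: (@frequently_subsequence (fun n => mdist v (x n) <= rho - e)) => N.
  (* [S] collects the late indices with good estimates; the cluster point [v] is approached along
     its image under [w]. *)
  pose S := [set n | (N <= n)%N /\ mdist u (c n) < rho + e /\ mdist (x n) (c n) < e].
  have near_S : (w @ \oo) (w @` S).
    by apply: filterS (filterI (nbhs_infty_ge N) (near_c e e0)) => n Sn; exists n.
  have near_v : nbhs v [set y | mdist v y < e].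
    by apply/nbhs_mdistP; exists e.
  have [_ [[n [Nn [h1 h2]] <-] h3]] := clv _ _ near_S near_v.
  exists n => //; have [_ wc _] := hw n.
  have := metric_triangle v (w n) (x n); have := metric_triangle (w n) (c n) (x n).
  rewrite wc (metric_sym (c n)) => h4 h5; move: h3 => /= h3.
  have h6 := mdist_ge0 u (c n).
  have : (1 - t) * mdist u (c n) <= (1 - t) * (rho + e).
    by apply: ler_wpM2l; lra.
  rewrite /e in h1 h2 h3 e0 *; nra.
(* Contradiction: [u] is a center of the subsequence with radius [rho], while [v] has radius at most
   [rho - e]. *)
have : asymptotic_center (x \o phi) u by have /seteqP[_] := centers _ incr; exact.
move/(asymptotic_centerP (bounded_subseq phi bx))/(_ v).
rewrite (asymptotic_radius_subseq cvgu incr) -/rho leNgt => /negP; apply.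
apply: (@le_lt_trans _ _ (rho - e)); last by rewrite ltrBlDr ltrDl.
by apply: asymptotic_radius_le; [exact: bounded_subseq|exact: nearW].
Qed.
End FejerConvergence.

(** * Cyclic projections with summable errors *)

Section CyclicProjections.
Variables (R : realType) (X : metricType R).
Hypotheses (complX : complete_space X) (catX : cat0_space X).
Variables (r : nat) (hr : (1 <= r)%N) (C : 'I_r -> set X).
Hypotheses (C0 : forall i, C i !=set0) (clC : forall i, closed (C i)).
Hypotheses (cvC : forall i, geod_convex (C i)) (F0 : (\bigcap_i C i) !=set0).
Variables (eps : nat -> R) (x : nat -> X).
Hypothesis cvg_eps : cvgn (series eps).
Let idx n := Ordinal (ltn_pmod n hr).
Let y n := metric_proj (C (idx n)) (x n).
Hypothesis hx : forall n, mdist (x n.+1) (y n) <= eps n.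

Lemma cyclic_is_cvg_mdist p : (\bigcap_i C i) p -> cvgn (fun n => mdist p (x n)).
Proof.
move=> Fp; apply: is_cvg_quasi_nonincreasing cvg_eps _ => n.
  exact: mdist_ge0.
have := metric_proj_quasi_nonexpansive complX catX (x n) (@clC (idx n)) (@cvC (idx n)) (Fp _ I).
have := metric_triangle p (y n) (x n.+1); have := hx n.
by rewrite (metric_sym (y n) (x n.+1)) !(metric_sym p) /y; lra.
Qed.

Lemma cyclic_bounded : bounded_seq x.
Proof.
have [p Fp] := F0; have cvgp := cyclic_is_cvg_mdist Fp.
have [M pM] := bounded_fun_has_ubound (cvg_seq_bounded cvgp).
by exists p, M => n; apply: pM; exists n.
Qed.

Lemma cvg_eps_0 : eps n @[n --> \oo] --> 0.
Proof. exact: cvg_series_cvg_0 cvg_eps. Qed.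

(** With [q = mdist p (y n)] and [s n = mdist p (x n)], the Pythagorean inequality bounds the
    squared residual by [(s n - q) * (s n + q)]. The first factor is at most [s n - s n.+1 + eps n],
    which tends to 0; the second is at most [2 * s n]. *)
Lemma cyclic_residual_cvg0 : mdist (x n) (y n) @[n --> \oo] --> 0.
Proof.
have [p Fp] := F0; have cvgp := cyclic_is_cvg_mdist Fp.
pose s n := mdist p (x n).
have s_cvg : s n @[n --> \oo] --> limn s by exact: cvgp.
have sS_cvg : s n.+1 @[n --> \oo] --> limn s.
  by have := s_cvg; rewrite -(cvg_shiftS s).
have bnd : ((s n - s n.+1 + eps n) * (2 * s n)) @[n --> \oo] --> 0.
  rewrite (_ : 0 = (limn s - limn s + 0) * (2 * limn s)); last by ring.
  apply: cvgM; last by apply: cvgM => //; exact: cvg_cst.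
  by apply: cvgD; [exact: cvgB|exact: cvg_eps_0].
have res_le n : mdist (x n) (y n) ^+ 2 <= (s n - s n.+1 + eps n) * (2 * s n).
  have near_y := metric_projP complX catX (x n) (@clC (idx n)) (@cvC (idx n)) (C0 _).
  have := nearest_point_pythagoras catX (@cvC _) near_y (Fp _ I).
  rewrite -/(y n).
  have := metric_triangle p (y n) (x n.+1); have := hx n.
  rewrite (metric_sym (y n) (x n.+1)) (metric_sym (y n) p) (metric_sym (x n) p).
  rewrite -/(s n) -/(s n.+1).
  have := mdist_ge0 p (y n); have : 0 <= s n := mdist_ge0 _ _.
  have := mdist_ge0 (x n) (y n).
  set q := mdist p (y n); set b := mdist _ _ => b0 s0 q0 h1 h2 h3.
  have qs : q <= s n by nra.
  have : s n - q <= s n - s n.+1 + eps n by lra.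
  nra.
apply/cvgr0Pnorm_lt => e e0.
have e20 : 0 < e ^+ 2 by rewrite exprn_gt0.
apply: filterS (cvgr_lt _ bnd _ e20) => n lt_e.
rewrite ger0_norm ?mdist_ge0//.
rewrite -(@ltr_pXn2r _ 2) ?nnegrE ?mdist_ge0 ?(ltW e0)//.
exact: le_lt_trans (res_le n) lt_e.
Qed.

(* Within r steps the sequence projects onto every C i, and consecutive terms
   get arbitrarily close. *)
Lemma cyclic_asymptotically_in i : asymptotically_in (C i) x.
Proof.
apply/cvgr0Pnorm_lt => e e0.
(* Each step moves by less than [2 * d], a residual plus an error; fewer than [r] steps and one last
   residual stay below [(2 * r + 2) * d = e]. *)
pose d := e / (2 * r + 2)%:R.
have den : 0 < (2 * r + 2)%:R :> R by rewrite ltr0n addn2.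
have d0 : 0 < d by rewrite divr_gt0.
have [N _ hN] : \forall n \near \oo, mdist (x n) (y n) < d /\ eps n < d.
  exact: filterS2 (cvgr_lt _ cyclic_residual_cvg0 _ d0) (cvgr_lt _ cvg_eps_0 _ d0).
exists N => // n /= Nn; rewrite ger0_norm ?mdist_ge0//.
have steps k : mdist (x n) (x (n + k)%N) <= (2 * k)%:R * d.
  elim: k => [|k ih]; first by rewrite addn0 mdistxx mul0r.
  rewrite addnS; have [|h1 h2] := hN (n + k)%N; first exact: leq_trans (leq_addr _ _).
  have := metric_triangle (x n) (x (n + k)%N) (x (n + k).+1).
  have := metric_triangle (x (n + k)%N) (y (n + k)%N) (x (n + k).+1).
  have := hx (n + k)%N.
  rewrite (metric_sym (y _)) mulnS natrD mulrDl => h3 h4 h5; lra.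
(* The number of steps until the cyclic index is [i]; adding [r - n %% r] stands for subtracting [n]
   modulo [r]. *)
pose k := ((i + (r - n %% r)) %% r)%N.
have kr : (k < r)%N by exact: ltn_pmod.
have idx_nk : idx (n + k) = i.
  apply/val_inj => /=; rewrite /k modnDmr.
  have -> : ((n + (i + (r - n %% r))) %% r = (i + (n %/ r).+1 * r) %% r)%N.
    congr (_ %% _)%N; rewrite {1}(divn_eq n r); have := ltn_pmod n hr; lia.
  by rewrite addnC modnMDl modn_small.
have [|h1 _] := hN (n + k)%N; first exact: leq_trans (leq_addr _ _).
have near_n := metric_projP complX catX (x n) (@clC i) (@cvC i) (C0 i).
have near_k := metric_projP complX catX (x (n + k)%N) (@clC i) (@cvC i) (C0 i).
(* The projection of [x (n + k)] is a competitor in [C i], so its distance to [x n] bounds the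
   residual at [n]. *)
have /nearest_pointP[_ /(_ _ (proj1 near_k))le_n] := near_n.
rewrite /y idx_nk in h1.
have := metric_triangle (x n) (x (n + k)%N) (metric_proj (C i) (x (n + k)%N)).
have sk := steps k.
have : (2 * k)%:R * d <= (2 * r)%:R * d by rewrite ler_pM2r// ler_nat leq_mul2l ltnW.
have : (2 * r)%:R * d + 2 * d = e.
  by rewrite -mulrDl -natrD /d mulrC divfK// gt_eqF.
lra.
Qed.
End CyclicProjections.

(* Sets are indexed from 0: the set C_(n mod r + 1) is C (n %% r). *)
Theorem corollary4p2 (R : realType) (X : metricType R)
  (hcomplete : complete_space X) (hcat0 : cat0_space X)
  (r : nat) (hr : (1 <= r)%N) (C : 'I_r -> set X)
  (hC0 : forall i, C i !=set0)
  (hCcl : forall i, closed (C i))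
  (hCcv : forall i, geod_convex (C i))
  (hCI : (\bigcap_i C i) !=set0)
  (eps : nat -> R) (heps0 : forall n, 0 <= eps n)
  (heps : (\sum_(0 <= n <oo) (eps n)%:E < +oo)%E)
  (x0 : X) (x : nat -> X) (hx0 : x 0%N = x0)
  (hx : forall n : nat,
     mdist (x n.+1) (metric_proj (C (Ordinal (ltn_pmod n hr))) (x n)) <= eps n) :
  exists u : X,
    [/\ (\bigcap_i C i) u,
        Delta_cvg x u &
        (exists i, locally_compact (C i)) -> x @ \oo --> u].
Proof.
have cvg_eps := is_cvg_series_of_nneseries heps0 heps.
have cvg_mdist p := cyclic_is_cvg_mdist hcomplete hcat0 hCcl hCcv cvg_eps hx (p := p).
have bx := cyclic_bounded hcomplete hcat0 hCcl hCcv hCI cvg_eps hx.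
have xC := cyclic_asymptotically_in hcomplete hcat0 hC0 hCcl hCcv hCI cvg_eps hx.
have [u Fu ux] := fejer_Delta_cvg hcomplete hcat0 hCcl hCcv hC0 bx xC cvg_mdist.
exists u; split=> // -[i lcC].
exact: (Delta_cvg_locally_compact hcomplete hcat0 (hCcl i) (hCcv i) lcC (Fu i I) ux
  (xC i) (cvg_mdist u Fu)).
Qed.
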